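(* Let $n\geq 1$ be an integer and let $\zeta\in\mathbb{R}$ be a real number that is not algebraic of degree $\leq n$. Then \[ w_{n}^{\ast}(\zeta)\geq \frac{1}{\widehat{w}_{n}^{\prime}(\zeta)} \qquad\text{and}\qquad \widehat{w}_{n}^{\ast}(\zeta)\geq \frac{1}{w_{n}^{\prime}(\zeta)}. \]
   Context: For an algebraic number $\alpha$, $H(\alpha)$ denotes the largest absolute value of the coefficients of its minimal polynomial over $\mathbb{Z}$ with relatively prime integer coefficients. $w_{n}^{\ast}(\zeta)$ is the supremum of all real $\nu$ such that $\vert\zeta-\alpha\vert\leq H(\alpha)^{-\nu-1}$ has infinitely many solutions $\alpha$ algebraic of degree $\leq n$. $\widehat{w}_{n}^{\ast}(\zeta)$ is the supremum of all real $\nu$ such that for every sufficiently large $H$ there exists an algebraic number $\alpha$ of degree $\leq n$ with $H(\alpha)\leq H$ and $\vert\zeta-\alpha\vert\leq H(\alpha)^{-1}H^{-\nu}$. $w_{n}^{\prime}(\zeta)$ (resp. $\widehat{w}_{n}^{\prime}(\zeta)$) is the supremum of all real $\nu$ such that the system $\vert x\vert\leq X$, $\vert \zeta^{i}x-y_{i}\vert\leq X^{-\nu}$ ($1\leq i\leq n$) has a nonzero integer solution $(x,y_{1},\ldots,y_{n})\in\mathbb{Z}^{n+1}$ for arbitrarily large values of $X$ (resp. for all sufficiently large $X$). The convention $1/\infty=0$ is used. *)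

(* Defs.v *)
From HB Require Import structures.
From mathcomp Require Import all_boot all_order all_algebra.
From mathcomp Require Import intdiv.
From mathcomp Require Import all_classical all_reals.
From mathcomp Require Import ereal topology normedtype exp.
From mathcomp Require Import complex.

Set Implicit Arguments.
Unset Strict Implicit.
Unset Printing Implicit Defensive.

Import Order.TTheory GRing.Theory Num.Theory.
Local Open Scope classical_set_scope.
Local Open Scope ring_scope.

Section Defs.
Variable R : realType.

Definition minpoly_Z_le (n : nat) (P : {poly int}) (alpha : R[i]) : Prop :=
  [/\ (1 < size P <= n.+1)%N,
      `|zcontents P| = 1,
      irreducible_poly (map_poly (intr : int -> rat) P)
    & root (map_poly (intr : int -> R[i]) P) alpha].

Definition algebraic_le (n : nat) (alpha : R[i]) : Prop :=
  exists P, minpoly_Z_le n P alpha.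

Definition height (P : {poly int}) : R :=
  (\big[maxn/0%N]_(i < size P) absz (P`_i))%:R.

Definition cdist (zeta : R) (alpha : R[i]) : R :=
  Num.sqrt ((zeta - complex.Re alpha) ^+ 2 + (complex.Im alpha) ^+ 2).

Definition w_star (n : nat) (zeta : R) : \bar R :=
  ereal_sup [set nu%:E | nu in
    [set nu : R | infinite_set [set alpha : R[i] | exists P,
        minpoly_Z_le n P alpha /\ cdist zeta alpha <= height P `^ (- nu - 1)]]].

Definition hw_star (n : nat) (zeta : R) : \bar R :=
  ereal_sup [set nu%:E | nu in
    [set nu : R | exists H0 : R, forall H : R, H0 <= H ->
        exists (alpha : R[i]) (P : {poly int}), [/\ minpoly_Z_le n P alpha,
          height P <= H &
          cdist zeta alpha <= (height P)^-1 * H `^ (- nu)]]].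

Definition approx_sys (n : nat) (zeta X nu : R) : Prop :=
  exists (x : int) (y : 'I_n -> int),
    [/\ x != 0 \/ (exists i, y i != 0),
        `|(x%:~R : R)| <= X &
        forall i : 'I_n, `|zeta ^+ i.+1 * x%:~R - (y i)%:~R| <= X `^ (- nu)].

Definition w_prime (n : nat) (zeta : R) : \bar R :=
  ereal_sup [set nu%:E | nu in
    [set nu : R | forall X0 : R, exists X : R, X0 <= X /\ approx_sys n zeta X nu]].

Definition hw_prime (n : nat) (zeta : R) : \bar R :=
  ereal_sup [set nu%:E | nu in
    [set nu : R | exists X0 : R, forall X : R, X0 <= X -> approx_sys n zeta X nu]].

Definition einv (x : \bar R) : \bar R :=
  match x with
  | EFin r => (r^-1)%:E
  | _ => 0%E
  end.

End Defs.

(* Main.v *)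
(* If the convex body |x| <= X, |zeta^i x - y_i| <= 1/Y contains no nonzero
   integer point, then by duality every real polynomial Q of degree <= n is
   within a body of comparable size of some integer polynomial A:
   |(Q - A)(zeta)| << 1/X, with coefficients of Q - A being << Y. Choosing
   Q = (K Y (T - zeta) - T^n - 2) / 4, the polynomial P = T^n + 2 + 4 A is
   Eisenstein at 2 and close to K Y (T - zeta), so |P(zeta)| << 1/X,
   |P'(zeta)| >= Y and H(P) << Y. Some root alpha of P then satisfies
   |zeta - alpha| << 1/(X Y). Taking Y = X^mu with mu larger than the exponent
   of simultaneous approximation gives both inequalities. *)
Require Import Defs.
From HB Require Import structures.
From mathcomp Require Import all_boot all_order all_algebra.
From mathcomp Require Import all_classical all_reals.
From mathcomp Require Import complex.
From mathcomp Require Import ereal exp ring lra zify.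

Set Implicit Arguments.
Unset Strict Implicit.
Unset Printing Implicit Defensive.

Import Order.TTheory GRing.Theory Num.Theory.
Local Open Scope ring_scope.

(** * Covering radius of the dual of a lattice without short vectors *)

Section Covering.
Variable R : realType.
Implicit Types m d : nat.

Local Notation toR := (map_mx (intr : int -> R)).

Definition rdot m (u v : 'rV[R]_m) : R := (u *m v^T) 0 0.

Lemma rdotE m (u v : 'rV[R]_m) : rdot u v = \sum_k u 0 k * v 0 k.
Proof. by rewrite /rdot mxE; apply: eq_bigr => k _; rewrite !mxE. Qed.

Lemma rdotC m (u v : 'rV[R]_m) : rdot u v = rdot v u.
Proof. by rewrite !rdotE; apply: eq_bigr => k _; rewrite mulrC. Qed.

Lemma rdotDl m (u v w : 'rV[R]_m) : rdot (u + v) w = rdot u w + rdot v w.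
Proof. by rewrite /rdot mulmxDl mxE. Qed.

Lemma rdotZl m a (u w : 'rV[R]_m) : rdot (a *: u) w = a * rdot u w.
Proof. by rewrite /rdot -scalemxAl mxE. Qed.

Lemma rdot_ge0 m (u : 'rV[R]_m) : 0 <= rdot u u.
Proof. by rewrite rdotE sumr_ge0 // => k _; rewrite -expr2 sqr_ge0. Qed.

Lemma sqr_le_rdot m (u : 'rV[R]_m) k : u 0 k ^+ 2 <= rdot u u.
Proof.
rewrite rdotE (bigD1 k) //= -expr2 lerDl sumr_ge0 // => j _.
by rewrite -expr2 sqr_ge0.
Qed.

Lemma rdot_orthoD m (u v : 'rV[R]_m) a :
  rdot u v = 0 -> rdot (u + a *: v) (u + a *: v) = rdot u u + a ^+ 2 * rdot v v.
Proof.
move=> uv; rewrite rdotDl !rdotZl rdotC rdotDl rdotZl (rdotC v u) uv.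
by rewrite (rdotC v) rdotDl rdotZl uv; ring.
Qed.

Lemma rdot_proj m (u v : 'rV[R]_m) :
  rdot v v != 0 -> rdot (u - (rdot u v / rdot v v) *: v) v = 0.
Proof. by move=> v0; rewrite rdotDl -scaleNr rdotZl mulNr divfK // subrr. Qed.

Lemma nearest_int (s : R) : exists k : int, (s - k%:~R) ^+ 2 <= 1 / 4.
Proof.
exists (Num.floor (s + 1 / 2)).
have := floor_le (s + 1 / 2); have := floorD1_gt (s + 1 / 2).
rewrite intrD; move: (_%:~R) => f h1 h2.
have : (1 / 2 - (s - f)) * (1 / 2 + (s - f)) >= 0 by apply: mulr_ge0; lra.
lra.
Qed.

(* Smith normal form writes a nonzero integer row vector as an integer multiple
   of the first row of a unimodular matrix. *)
Lemma int_row_completion d (z : 'rV[int]_(1 + d)) : z != 0 ->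
  exists (U : 'M[int]_(1 + d)) (k : int),
    [/\ U \in unitmx, k != 0 & z = k *: usubmx U].
Proof.
move=> z0; have [L _ [U uU [e _ zE]]] := int_Smith_normal_form z.
have {}zE : z = (L 0 0 * e`_0) *: usubmx U.
  rewrite zE; apply/rowP => j.
  rewrite !mxE (bigD1 (lshift d 0)) //= big1 ?addr0.
    rewrite !mxE big_ord1 !mxE /= mulr1n; congr (_ * U _ _).
  move=> i i0; rewrite !mxE big_ord1 !mxE /=.
  suff /negPf -> : (0 != i :> nat)%N by rewrite mulr0n mulr0 mul0r.
  by apply: contraNneq i0 => i0; apply/eqP/val_inj.
exists U, (L 0 0 * e`_0); split=> //.
by apply: contraNneq z0 => k0; rewrite zE k0 scale0r.
Qed.

Lemma toR_unit d (U : 'M[int]_d) : U \in unitmx -> toR U \in unitmx.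
Proof. by rewrite !unitmxE det_map_mx; apply: rmorph_unit. Qed.

(** The infimum [mu] of the squared norms is positive, so some nonzero vector has squared norm below
    [2 * mu], whether or not [mu] is attained. Dividing it by its content only shortens it and makes
    it a basis row. *)
Lemma near_shortest_basis m d (lam : R) (B : 'M[R]_(1 + d, m)) : 0 < lam ->
  (forall z : 'rV[int]_(1 + d), z != 0 ->
     lam <= rdot (toR z *m B) (toR z *m B)) ->
  exists (mu : R) (U : 'M[int]_(1 + d)),
    [/\ lam <= mu, U \in unitmx,
        rdot (usubmx (toR U *m B)) (usubmx (toR U *m B)) <= 2 * mu &
        forall z : 'rV[int]_(1 + d), z != 0 ->
          mu <= rdot (toR z *m B) (toR z *m B)].
Proof.
move=> lam0 hB.
pose S := [set x : R | exists2 z : 'rV[int]_(1 + d), z != 0 &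
  x = rdot (toR z *m B) (toR z *m B)]%classic.
have S0 : (S !=set0)%classic.
  exists (rdot (toR (const_mx 1) *m B) (toR (const_mx 1) *m B)).
  exists (const_mx 1) => //.
  by apply/eqP => /rowP /(_ 0); rewrite !mxE => /eqP; rewrite oner_eq0.
have Slb : lbound S lam by move=> _ [z z0 ->]; apply: hB.
have lamS : lam <= inf S by apply: lb_le_inf.
have hS : forall z : 'rV[int]_(1 + d), z != 0 ->
    inf S <= rdot (toR z *m B) (toR z *m B).
  by move=> z z0; apply: ge_inf; [exists lam | exists z].
have infS : has_inf S by split=> //; exists lam.
have [_ [z z0 ->]] := inf_adherent (lt_le_trans lam0 lamS) infS.
have [U [k [uU k0 ->]]] := int_row_completion z0 => /ltW hz.
exists (inf S), U; split=> //.
rewrite mulrDl mul1r (le_trans _ hz) // map_mxZ -scalemxAl.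
rewrite map_usubmx -mul_usub_mx rdotZl rdotC rdotZl mulrA ler_peMl ?rdot_ge0 //.
rewrite -intrM (_ : 1 = 1%:~R) // ler_int -expr2.
by rewrite -gtz0_ge1 exprn_even_gt0.
Qed.

(* The rows of B span a lattice with no short nonzero vector, so its dual has
   covering radius O(1): split off a nearly shortest vector v and cover the
   points of the hyperplane orthogonal to v by induction, where projecting away
   v at most halves the minimal squared norm. *)
Lemma dual_covering m d (lam : R) (B : 'M[R]_(d, m)) (t : 'cV[R]_d) : 0 < lam ->
  (forall z : 'rV[int]_d, z != 0 -> lam <= rdot (toR z *m B) (toR z *m B)) ->
  exists (x : 'rV[R]_m) (a : 'cV[int]_d),
    B *m x^T = t - toR a /\ rdot x x <= 4 ^+ d / lam.
Proof.
elim: d => [|d IH] in lam B t *.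
  move=> lam0 _; exists 0, 0; split; first by rewrite flatmx0 [RHS]flatmx0.
  by rewrite /rdot mul0mx mxE divr_ge0 ?exprn_ge0 // ltW.
rewrite -[d.+1]/(1 + d)%N in B t * => lam0 hB.
have [mu [U [lmu uU]]] := near_shortest_basis lam0 hB.
pose B1 := toR U *m B; rewrite -/B1; set v := usubmx B1 => vmu hmu {hB}.
have mu0 : 0 < mu by apply: lt_le_trans lmu.
have hB1 (z : 'rV[int]_(1 + d)) : z != 0 ->
    mu <= rdot (toR z *m B1) (toR z *m B1).
  move=> z0; rewrite /B1 mulmxA -map_mxM; apply: hmu.
  by apply: contraNneq z0 => zU; rewrite -(mulmxK uU z) zU mul0mx.
have B1E : B1 = col_mx v (dsubmx B1) by rewrite vsubmxK.
set W := dsubmx B1 in B1E.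
have vge : mu <= rdot v v.
  have := hB1 (row_mx 1%:M 0); rewrite map_row_mx map_mx1 map_mx0 B1E.
  rewrite mul_row_col mul1mx mul0mx addr0; apply.
  by apply/eqP => /rowP /(_ (lshift d 0)); rewrite row_mxEl !mxE eqxx => /eqP.
have v0 : 0 < rdot v v by apply: lt_le_trans vge.
have vn0 : rdot v v != 0 by rewrite gt_eqF.
pose W' := W - ((rdot v v)^-1 *: (W *m v^T)) *m v.
have W'v : W' *m v^T = 0.
  rewrite mulmxBl -mulmxA [v *m _]mx11_scalar -/(rdot v v) mul_mx_scalar.
  by rewrite scalerA divff // scale1r subrr.
have mu20 : 0 < mu / 2 by rewrite divr_gt0.
(* A projected vector lifts to a nonzero lattice vector; subtracting the integer nearest to [s]
   leaves a component along [v] of squared norm at most [rdot v v / 4], hence at most [mu / 2]. *)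
have hW' (z : 'rV[int]_d) : z != 0 ->
    mu / 2 <= rdot (toR z *m W') (toR z *m W').
  move=> z0; pose s := rdot (toR z *m W) v / rdot v v.
  have [k hk] := nearest_int s.
  have /hB1 : row_mx (- k%:M) z != 0.
    apply: contraNneq z0 => /rowP h; apply/eqP/rowP => j.
    by have := h (rshift 1 j); rewrite row_mxEr !mxE.
  have -> : toR (row_mx (- k%:M) z) *m B1 = toR z *m W' + (s - k%:~R) *: v.
    rewrite map_row_mx B1E mul_row_col map_mxN map_scalar_mx mulNmx.
    rewrite mul_scalar_mx mulmxBr -scalemxAl -scalemxAr !mulmxA [_ *m v^T]mx11_scalar.
    rewrite -/(rdot _ _) mul_scalar_mx scalerA mulrC -/s scalerBl.
    by rewrite addrC addrA subrK.
  rewrite rdot_orthoD; last by rewrite /rdot -mulmxA W'v mulmx0 mxE.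
  have := ler_wpM2r (ltW v0) hk; lra.
pose t1 := toR U *m t.
(* The target coordinate for the row [v] is rounded to [k]; a multiple of [v] realizes the error
   [s0], and [t'] subtracts what this multiple contributes to the rows [W]. *)
have [k hk] := nearest_int (usubmx t1 0 0); pose s0 := usubmx t1 0 0 - k%:~R.
pose t' := dsubmx t1 - (s0 / rdot v v) *: (W *m v^T).
have [x [a [xE xle]]] := IH _ W' t' mu20 hW'.
(* Removing the component along [v] does not lengthen [x], keeps its products with [W'], and makes
   the products with [W] equal to them. *)
pose x1 := x - (rdot x v / rdot v v) *: v.
have x1v : rdot x1 v = 0 by apply: rdot_proj.
have Wx1 : W *m x1^T = t' - toR a.
  rewrite -xE; transitivity (W' *m x1^T).
    rewrite mulmxBl -mulmxA [v *m _]mx11_scalar -/(rdot v x1) rdotC x1v.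
    by rewrite mul_mx_scalar scale0r subr0.
  by rewrite linearB /= linearZ /= mulmxBr -scalemxAr W'v scaler0 subr0.
exists (x1 + (s0 / rdot v v) *: v), (invmx U *m col_mx k%:M a); split.
  apply: (can_inj (mulKmx (toR_unit uU))); rewrite mulmxA -/B1 B1E.
  rewrite mulmxBr -/t1 -map_mxM mulmxA mulmxV // mul1mx map_col_mx.
  rewrite map_scalar_mx -[t1]vsubmxK opp_col_mx add_col_mx mul_col_mx.
  rewrite [trmx _]linearD linearZ /=.
  rewrite !mulmxDr -!scalemxAr Wx1 [v *m x1^T]mx11_scalar [v *m v^T]mx11_scalar.
  rewrite -/(rdot v x1) -/(rdot v v) rdotC x1v scale_scalar_mx divfK //.
  rewrite [usubmx t1]mx11_scalar /s0 rmorphB /= rmorph0 add0r; congr col_mx.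
  by rewrite /t' addrAC subrK.
rewrite rdot_orthoD //.
have s1 : (s0 / rdot v v) ^+ 2 * rdot v v <= 1 / 4 / lam.
  rewrite (_ : _ * _ = s0 ^+ 2 / rdot v v); last by field.
  apply: ler_pM hk _; first exact: sqr_ge0.
    by rewrite invr_ge0 ltW.
  by rewrite lef_pV2 ?posrE // (le_trans lmu).
have x1x : rdot x1 x1 <= rdot x x.
  have -> : rdot x x = rdot (x1 + (rdot x v / rdot v v) *: v)
                            (x1 + (rdot x v / rdot v v) *: v).
    by rewrite /x1 subrK.
  by rewrite rdot_orthoD // lerDl mulr_ge0 ?sqr_ge0 ?rdot_ge0.
(* The hyperplane contributes at most [2 * 4 ^+ d / lam] and the direction [v] at most
   [1 / 4 / lam], together below [4 ^+ d.+1 / lam]. *)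
have lamV : 4 ^+ d / (mu / 2) <= 2 * 4 ^+ d / lam.
  rewrite invf_div mulrA [_ * 2]mulrC ler_pM2l ?mulr_gt0 ?exprn_gt0 //.
  by rewrite lef_pV2.
have c1 : 1 / lam <= 4 ^+ d / lam
  by rewrite ler_pM2r ?invr_gt0 // exprn_ege1 // ler1n.
have l0 : 0 <= lam^-1 by rewrite invr_ge0 ltW.
move: xle lamV c1 s1 x1x; rewrite exprD expr1.
move: (4 ^+ d) (rdot _ _) (rdot _ _) => e p q; lra.
Qed.
End Covering.

(** * Integer polynomials close to a given real polynomial *)

Section PolyCovering.
Variables (R : realType) (n : nat) (zeta : R).

Local Notation toR := (map_mx (intr : int -> R)).
Local Notation toRP := (map_poly (intr : int -> R)).

(** The bounds on [x] and on the errors are independent here; they are later tied by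
    [X = Y^tau / 2]. *)
Definition insoluble (X Y : R) : Prop :=
  forall (x : int) (y : 'I_n -> int), x != 0 \/ (exists i, y i != 0) ->
    `|x%:~R : R| <= X ->
    ~ forall i : 'I_n, `|zeta ^+ i.+1 * x%:~R - (y i)%:~R| <= Y^-1.

(** [s] is the square root of the covering bound [4 ^+ n.+1] for [lam = 1]. In [c], the sum pays for
    the powers of [zeta] in the constant coefficient, and the 2 for its term over [X]. *)
Let s : R := 2 ^+ n.+1.
Let c : R := s * (2 + \sum_(i < n) `|zeta| ^+ i.+1).

(* X >= 1/2 and Y >= 1 are used to absorb the term c/X in the constant
   coefficient of Q - A into c Y. *)
Lemma poly_covering : exists2 c : R, 0 < c & forall X Y : R,
  1 / 2 <= X -> 1 <= Y -> insoluble X Y ->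
  forall Q : {poly R}, (size Q <= n.+1)%N ->
  exists A : {poly int},
    [/\ (size A <= n.+1)%N, `|(Q - toRP A).[zeta]| <= c / X &
        forall i, `|(Q - toRP A)`_i| <= c * Y].
Proof.
have s0 : 0 < s by rewrite exprn_gt0.
pose S := \sum_(i < n) `|zeta| ^+ i.+1.
have S0 : 0 <= S by apply: sumr_ge0 => i _; rewrite exprn_ge0.
exists c => [|X Y X2 Y1 XY Q sQ]; first by rewrite mulr_gt0 // -/S; lra.
have X0 : 0 < X by lra.
have Y0 : 0 < Y by lra.
(* An integer row [(x, y)] times [B] is [(x / X, Y (zeta^i x - y_i))], so a norm below 1 would solve
   the system. [B] times a real column lists the coefficients of a polynomial whose value at [zeta]
   is the first entry of the column over [X]. *)
pose B : 'M[R]_(1 + n) :=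
  block_mx (X^-1)%:M (\row_(i < n) (Y * zeta ^+ i.+1)) 0 (- Y)%:M.
have hB (z : 'rV[int]_(1 + n)) : z != 0 ->
    1 <= rdot (toR z *m B) (toR z *m B).
  move=> z0; rewrite leNgt; apply/negP => lt1.
  have small k : `|(toR z *m B) 0 k| <= 1.
    rewrite -ler_sqr ?nnegrE // expr1n real_normK ?num_real //.
    exact: le_trans (sqr_le_rdot _ _) (ltW lt1).
  have zE : toR z *m B = row_mx (X^-1 *: toR (lsubmx z))
      (\row_i (Y * (zeta ^+ i.+1 * (z 0 (lshift n 0))%:~R -
                    (z 0 (rshift 1 i))%:~R))).
    rewrite -{1}[z]hsubmxK map_row_mx mul_row_block mulmx0 addr0.
    rewrite !mul_mx_scalar; congr row_mx; apply/rowP => i.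
    by rewrite !mxE big_ord1 !mxE; ring.
  apply: (XY (z 0 (lshift n 0)) (fun i => z 0 (rshift 1 i))).
  - have [z00|z00] := eqVneq (z 0 (lshift n 0)) 0; [right|by left].
    apply/existsP; apply: contraNT z0; rewrite negb_exists => /forallP zi.
    apply/eqP/rowP => j; rewrite mxE.
    case: (split_ordP j) => k ->; first by rewrite ord1.
    by have := zi k; rewrite negbK => /eqP.
  - have := small (lshift n 0); rewrite zE row_mxEl !mxE.
    by rewrite normrM normfV (gtr0_norm X0) ler_pdivrMl // mulr1.
  - move=> i; have := small (rshift 1 i); rewrite zE row_mxEr !mxE.
    by rewrite normrM (gtr0_norm Y0) -ler_pdivlMl // mulr1.
have [x [a [xE xle]]] := dual_covering (\col_(j < 1 + n) Q`_j) ltr01 hB.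
have xs k : `|x 0 k| <= s.
  rewrite -ler_sqr ?nnegrE ?(ltW s0) // real_normK ?num_real //.
  apply: le_trans (sqr_le_rdot _ _) _.
  rewrite (le_trans xle) // invr1 mulr1 /s -exprM mulnC exprM.
  by rewrite (_ : 2 ^+ 2 = 4 :> R) // expr2; ring.
pose A := rVpoly a^T; pose D := Q - toRP A.
have sA : (size A <= n.+1)%N by rewrite size_poly.
have sD : (size D <= n.+1)%N.
  rewrite (leq_trans (size_polyD _ _)) // size_polyN geq_max sQ.
  by rewrite (leq_trans (size_poly _ _)).
have DE (j : 'I_(1 + n)) : D`_j = (B *m x^T) j 0.
  by rewrite xE !mxE coefB coef_map coef_rVpoly_ord mxE.
have D0 : D`_0 = X^-1 * x 0 (lshift n 0) +
    \sum_(i < n) Y * zeta ^+ i.+1 * x 0 (rshift 1 i).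
  rewrite (DE (lshift n 0)) -{1}[x]hsubmxK tr_row_mx mul_block_col col_mxEu.
  rewrite !mxE big_ord1 !mxE mulr1n; congr (_ + _).
  by apply: eq_bigr => i _; rewrite !mxE.
have DS (i : 'I_n) : D`_i.+1 = - Y * x 0 (rshift 1 i).
  rewrite (DE (rshift 1 i)) -{1}[x]hsubmxK tr_row_mx mul_block_col col_mxEd.
  by rewrite mul0mx add0r mul_scalar_mx !mxE.
exists A; split=> //.
- rewrite -/D (horner_coef_wide _ sD) big_ord_recl expr0 mulr1 D0 /=.
  rewrite -addrA -big_split big1 /= ?addr0; last first.
    by move=> i _; rewrite DS /bump /=; ring.
  rewrite normrM mulrC normfV (gtr0_norm X0) ler_pM2r ?invr_gt0 //.
  rewrite (le_trans (xs _)) // ler_peMr ?ltW // -/S; lra.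
move=> [|i]; rewrite -/D.
  rewrite D0 /c -/S (le_trans (ler_normD _ _)) //.
  have h1 : `|X^-1 * x 0 (lshift n 0)| <= s * 2 * Y.
    rewrite normrM mulrC -mulrA ler_pM //.
    rewrite normfV (gtr0_norm X0) (@le_trans _ _ 2) //; last lra.
    by rewrite -[2]invrK lef_pV2 ?posrE //; lra.
  have h2 : `|\sum_(i < n) Y * zeta ^+ i.+1 * x 0 (rshift 1 i)| <= s * S * Y.
    rewrite (le_trans (ler_norm_sum _ _ _)) // mulr_sumr mulr_suml.
    rewrite ler_sum // => i _.
    rewrite !normrM normrX (gtr0_norm Y0) -mulrA mulrC ler_pM2r // mulrC.
    by rewrite ler_wpM2r ?exprn_ge0.
  lra.
have [ni|ni] := ltnP i n; last first.
  by rewrite nth_default ?normr0 ?(leq_trans sD) // !mulr_ge0 // -/S; lra.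
rewrite (DS (Ordinal ni)) normrM normrN (gtr0_norm Y0) mulrC ler_pM2r //.
rewrite (le_trans (xs _)) // ler_peMr ?ltW // -/S; lra.
Qed.
End PolyCovering.

(** * Distance from a point to a nearby root *)

Lemma ex_mean_le (F : numDomainType) (T : eqType) (s : seq T) (f : T -> F) :
  (0 < size s)%N ->
  exists2 a, a \in s & \sum_(b <- s) `|f b| <= `|f a| *+ size s.
Proof.
elim: s => // x [_ _|y s IH _].
  by exists x; rewrite ?mem_seq1 // big_seq1.
have [a aS ha] := IH isT.
have [le_xa|/ltW le_ax] := real_leP (normr_real (f x)) (normr_real (f a)).
  exists a; first by rewrite in_cons aS orbT.
  by rewrite big_cons [size _]/= mulrS lerD.
exists x; first by rewrite in_cons eqxx.
rewrite big_cons [size _]/= mulrS lerD // (le_trans ha) //.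
by rewrite lerMn2r le_ax orbT.
Qed.

Lemma horner_deriv_prod_XsubC (F : fieldType) (s : seq F) z : z \notin s ->
  (\prod_(a <- s) ('X - a%:P))^`().[z] =
  (\prod_(a <- s) ('X - a%:P)).[z] * \sum_(a <- s) (z - a)^-1.
Proof.
elim: s => [|x s IH]; first by rewrite !big_nil mulr0 derivC horner0.
rewrite in_cons negb_or -subr_eq0 => /andP[zx zs].
rewrite !big_cons derivM derivXsubC !hornerE IH //.
by field.
Qed.

(** The logarithmic derivative at [z] is the sum of [1 / (z - a)] over the roots with multiplicity,
    so it is at most the degree times the largest term, in absolute value. *)
Lemma root_near (F : numClosedFieldType) (p : {poly F}) z :
  (1 < size p)%N -> p.[z] != 0 ->
  exists2 alpha, root p alpha &
    `|z - alpha| * `|p^`().[z]| <= (size p).-1%:R * `|p.[z]|.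
Proof.
move=> p1; have [s pE] := closed_field_poly_normal p.
have p0 : p != 0 by rewrite -size_poly_gt0 (ltn_trans _ p1).
have lp0 : lead_coef p != 0 by rewrite lead_coef_eq0.
have sE : (size p).-1 = size s.
  by rewrite pE size_scale // size_prod_XsubC.
have rootE a : root p a = (a \in s).
  by rewrite pE rootZ // root_prod_XsubC.
move=> pz0; have zs : z \notin s by rewrite -rootE.
have s0 : (0 < size s)%N by rewrite -sE -ltnS prednK // ltnW.
have [a aS ha] := ex_mean_le (fun a => (z - a)^-1) s0.
exists a; first by rewrite rootE.
have za : z - a != 0 by rewrite subr_eq0; apply: contraNneq zs => ->.
have -> : p^`().[z] = p.[z] * \sum_(b <- s) (z - b)^-1.
  by rewrite pE derivZ !hornerZ horner_deriv_prod_XsubC // mulrA.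
rewrite normrM mulrCA sE [leRHS]mulrC ler_wpM2l // mulrC.
rewrite -ler_pdivlMr ?normr_gt0 //.
by rewrite -normfV mulr_natl (le_trans (ler_norm_sum _ _ _)).
Qed.

(** * Heights, primitive parts and complex distances *)

Lemma height_le (R : realType) (P : {poly int}) (b : R) : 0 <= b ->
  (forall i, `|(P`_i)%:~R : R| <= b) -> height R P <= b.
Proof.
move=> b0 hP; rewrite /height.
apply: (big_ind (fun k : nat => k%:R <= b)) => // [k l kb lb|i _].
  by case: leqP.
by rewrite natr_absz intr_norm hP.
Qed.

Lemma height_ge1 (R : realType) (P : {poly int}) : P != 0 -> 1 <= height R P.
Proof.
move=> P0; rewrite /height ler1n.
have sP : ((size P).-1 < size P)%N by rewrite prednK ?size_poly_gt0.
apply: leq_trans (leq_bigmax (Ordinal sP)) => /=.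
by rewrite absz_gt0 -lead_coefE lead_coef_eq0.
Qed.

(** An Eisenstein polynomial at 2 may still have an odd content above 1; dividing by it preserves
    the roots and irreducibility over the rationals. *)
Lemma zprimitive_minpoly (R : realType) (n : nat) (P : {poly int})
    (alpha : R[i]) :
  (1 < size P <= n.+1)%N ->
  irreducible_poly (map_poly (intr : int -> rat) P) ->
  root (map_poly (intr : int -> R[i]) P) alpha ->
  minpoly_Z_le n (zprimitive P) alpha.
Proof.
move=> sP irrP rP; have P0 : P != 0.
  by rewrite -size_poly_gt0; case/andP: sP => /ltnW.
have k0 : zcontents P != 0 by rewrite zcontents_eq0.
split; first by rewrite size_zprimitive.
- by rewrite zcontents_primitive P0.
- have PE : map_poly (intr : int -> rat) P =
      (zcontents P)%:~R *: map_poly intr (zprimitive P).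
    by rewrite {1}[P]zpolyEprim map_polyZ.
  rewrite PE in irrP; case: irrP => s1 irrP.
  have k0q : (zcontents P)%:~R != 0 :> rat by rewrite intr_eq0.
  rewrite size_scale // in s1; split=> // q q1 qP.
  have := irrP q q1; rewrite dvdpZr // => /(_ qP) /eqp_trans; apply.
  exact: eqp_scale.
- by move: rP; rewrite {1}[P]zpolyEprim map_polyZ /= rootZ ?intr_eq0.
Qed.

Lemma height_zprimitive (R : realType) (P : {poly int}) (b : R) : 0 <= b ->
  (forall i, `|(P`_i)%:~R : R| <= b) -> height R (zprimitive P) <= b.
Proof.
move=> b0 hP; apply: height_le => // i; apply: le_trans (hP i).
have [->|P0] := eqVneq P 0; first by rewrite zprimitive0.
rewrite {2}[P]zpolyEprim coefZ intrM normrM ler_peMl //.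
by rewrite -intr_norm -[1]/(1%:~R) ler_int -gtz0_ge1 normr_gt0 zcontents_eq0.
Qed.

Lemma normc_real (R : rcfType) (x : R) : `|(x%:C)%C| = (`|x|%:C)%C.
Proof. by rewrite normc_def /= expr0n /= addr0 sqrtr_sqr. Qed.

Lemma norm_sub_cdist (R : realType) (zeta : R) (alpha : R[i]) :
  `|(zeta%:C)%C - alpha| = ((cdist zeta alpha)%:C)%C.
Proof.
by rewrite normc_def /cdist; case: alpha => a b /=; rewrite sub0r sqrrN.
Qed.

Lemma horner_intrC (R : realType) (P : {poly int}) (zeta : R) :
  (map_poly (intr : int -> R[i]) P).[(zeta%:C)%C] =
  ((map_poly (intr : int -> R) P).[zeta]%:C)%C.
Proof.
rewrite -horner_map /= -map_poly_comp; congr horner.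
by apply: eq_map_poly => x /=; rewrite rmorph_int.
Qed.

Lemma cdist_root_le (R : realType) (n : nat) (P : {poly int}) (zeta : R) :
  (1 < size P <= n.+1)%N -> (map_poly (intr : int -> R) P).[zeta] != 0 ->
  exists2 alpha : R[i], root (map_poly (intr : int -> R[i]) P) alpha &
    cdist zeta alpha * `|(map_poly (intr : int -> R) P)^`().[zeta]| <=
    n%:R * `|(map_poly (intr : int -> R) P).[zeta]|.
Proof.
move=> /andP[s1 sn] Pz; pose p := map_poly (intr : int -> R[i]) P.
have sp : size p = size P by apply: size_map_inj_poly => //; apply: intr_inj.
have pz : p.[(zeta%:C)%C] != 0.
  by rewrite horner_intrC -[0]/((0%:C)%C) (inj_eq (@complexI _)).
have sp1 : (1 < size p)%N by rewrite sp.
have [alpha ra] := root_near sp1 pz.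
rewrite norm_sub_cdist deriv_map !horner_intrC !normc_real sp => h.
exists alpha => //; rewrite deriv_map.
move: h; rewrite -(rmorph_nat (real_complex R)) -!rmorphM lecR => /le_trans.
apply.
by rewrite ler_wpM2r // ler_nat -ltnS prednK // ltnW.
Qed.

(** * The Eisenstein polynomial and its root near [zeta] *)

Lemma eisenstein_two (n : nat) (A : {poly int}) :
  (1 <= n)%N -> (size A <= n.+1)%N ->
  let P := 'X^n + 2%:P + 4 *: A in
  size P = n.+1 /\ irreducible_poly (map_poly (intr : int -> rat) P).
Proof.
move=> n1 sA P.
have Pn : P`_n = 1 + 4 * A`_n.
  by rewrite !coefD coefXn coefC coefZ eqxx gtn_eqF // addr0.
have sP : size P = n.+1.
  apply/eqP; rewrite eqn_leq; apply/andP; split.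
    rewrite (leq_trans (size_polyD _ _)) // geq_max.
    rewrite (leq_trans (size_scale_leq _ _)) //.
    rewrite andbT (leq_trans (size_polyD _ _)) // geq_max size_polyXn leqnn.
    by rewrite (leq_trans (size_polyC_leq1 _)).
  rewrite ltnNge; apply/negP => /leq_sizeP /(_ n (leqnn n)); rewrite Pn; lia.
(* Modulo 4 the leading coefficient is 1, the constant one is 2 and the others are 0; [1 <= n] keeps
   the first two apart. *)
split=> //; apply/irreducible_rat_int/(@eisenstein_crit 2) => //; rewrite ?sP.
- by rewrite eqSS -lt0n.
- by rewrite lead_coefE sP Pn; lia.
- by rewrite !coefD coefXn coefC coefZ ltn_eqF //= add0r; lia.
move=> i /= ilt; rewrite !coefD coefXn coefC coefZ ltn_eqF //= add0r.
by case: (i == 0%N); lia.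
Qed.

Lemma algebraic_approx (R : realType) (n : nat) (zeta : R) :
  (1 <= n)%N -> ~ algebraic_le n (zeta%:C)%C ->
  exists M c : R, [/\ 0 < M, 0 < c & forall X Y : R,
    1 / 2 <= X -> 1 <= Y -> insoluble n zeta X Y ->
    exists (alpha : R[i]) (P : {poly int}),
      [/\ minpoly_Z_le n P alpha, height R P <= M * Y &
          cdist zeta alpha <= c / (X * Y)]].
Proof.
move=> n1 nalg; have [c c0 hc] := poly_covering n zeta.
pose S := \sum_(i < n) `|zeta| ^+ i *+ i.+1.
have S0 : 0 <= S by apply: sumr_ge0 => i _; rewrite mulrn_wge0 ?exprn_ge0.
(* Since [P'(zeta) = K Y - 4 D'(zeta)] with [|D'(zeta)| <= c Y S], this [K] leaves
   [|P'(zeta)| >= Y]. *)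
pose K := 4 * c * S + 1.
have K0 : 0 < K by rewrite ltr_wpDl // !mulr_ge0 // ltW.
have Kz0 : 0 <= K * (1 + `|zeta|) by rewrite mulr_ge0 ?(ltW K0) ?addr_ge0.
have M0 : 0 < K * (1 + `|zeta|) + 4 * c by rewrite ltr_wpDl ?mulr_gt0.
exists (K * (1 + `|zeta|) + 4 * c), (n%:R * (4 * c)); split.
- exact: M0.
- by rewrite !mulr_gt0 // ltr0n.
move=> X Y X2 Y1 XY; have X0 : 0 < X by lra.
have Y0 : 0 < Y by lra.
pose Q1 : {poly R} := (K * Y) *: ('X - zeta%:P).
pose Q : {poly R} := 4^-1 *: (Q1 - 'X^n - 2%:P).
have sQ : (size Q <= n.+1)%N.
  rewrite (leq_trans (size_scale_leq _ _)) // (leq_trans (size_polyD _ _)) //.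
  rewrite size_polyN geq_max (leq_trans (size_polyC_leq1 _)) // andbT.
  rewrite (leq_trans (size_polyD _ _)) // size_polyN size_polyXn.
  rewrite geq_max leqnn andbT.
  by rewrite (leq_trans (size_scale_leq _ _)) // size_XsubC ltnS.
have [A [sA Dz DY]] := hc X Y X2 Y1 XY Q sQ.
have [sP irrP] := eisenstein_two n1 sA.
set P := 'X^n + _ + _ in sP irrP.
set D := Q - _ in Dz DY.
have sD : (size D <= n.+1)%N.
  rewrite (leq_trans (size_polyD _ _)) // size_polyN geq_max sQ.
  by rewrite (leq_trans (size_poly _ _)).
have PE : map_poly (intr : int -> R) P = Q1 - 4 *: D.
  rewrite /P !rmorphD /= map_polyXn map_polyC map_polyZ /= /D scalerBr.
  rewrite /Q scalerA mulfV ?pnatr_eq0 // scale1r.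
  by ring.
clearbody D.
have P'z : Y <= `|(map_poly (intr : int -> R) P)^`().[zeta]|.
  rewrite PE derivB !derivZ derivXsubC !hornerE.
  have D'z : `|D^`().[zeta]| <= c * Y * S.
    have sD' : (size D^`() <= n)%N by apply: leq_trans (size_poly _ _) _; lia.
    rewrite (horner_coef_wide _ sD') (le_trans (ler_norm_sum _ _ _)) // /S.
    rewrite mulr_sumr ler_sum // => i _.
    rewrite coef_deriv normrM normrX normrMn mulrnAl -mulrnAr.
    by rewrite ler_wpM2r // mulrn_wge0 ?exprn_ge0.
  rewrite (le_trans _ (lerB_dist _ _)) // !normrM (gtr0_norm K0) (gtr0_norm Y0).
  rewrite (gtr0_norm (ltr0Sn _ _)) /K; lra.
have Pz : `|(map_poly (intr : int -> R) P).[zeta]| <= 4 * c / X.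
  rewrite PE !hornerE subrr mulr0 sub0r normrN normrM (gtr0_norm (ltr0Sn _ _)).
  by rewrite -mulrA ler_wpM2l.
have hP i : `|(P`_i)%:~R : R| <= (K * (1 + `|zeta|) + 4 * c) * Y.
  rewrite -coef_map PE coefB !coefZ coefB coefX coefC.
  rewrite (le_trans (ler_normB _ _)) // !normrM (gtr0_norm K0) (gtr0_norm Y0).
  rewrite (gtr0_norm (ltr0Sn _ _)) [leRHS]mulrDl lerD //; last first.
    by rewrite -mulrA ler_wpM2l.
  rewrite mulrAC ler_pM2r // ler_pM2l // (le_trans (ler_normB _ _)) //.
  by rewrite lerD //; case: i => [|[|i]]; rewrite ?normr0 ?normr1.
have irr_size : (1 < size P <= n.+1)%N by rewrite sP ltnS n1 leqnn.
have Pz0 : (map_poly (intr : int -> R) P).[zeta] != 0.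
  apply/eqP => Pz0; apply: nalg; exists (zprimitive P).
  by apply: zprimitive_minpoly => //; rewrite /root horner_intrC Pz0.
have [alpha ra dalpha] := cdist_root_le irr_size Pz0.
exists alpha, (zprimitive P); split; first exact: zprimitive_minpoly.
- by apply: height_zprimitive => //; rewrite ltW ?mulr_gt0.
have d0 : 0 <= cdist zeta alpha by rewrite sqrtr_ge0.
rewrite invfM [leRHS]mulrA ler_pdivlMr //.
have := ler_wpM2l d0 P'z; have := ler_wpM2l (ler0n R n) Pz; lra.
Qed.

(** * Real powers and absorption of constants *)

Lemma powR_unbounded (R : realType) (e b : R) : 0 < e ->
  exists Y0 : R, forall Y, Y0 <= Y -> b <= Y `^ e.
Proof.
move=> e0; exists (`|b| `^ e^-1) => Y hY; apply: le_trans (ler_norm b) _.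
rewrite -[leLHS]powRr1 // -(mulVf (lt0r_neq0 e0)) powRrM.
apply: ge0_ler_powR => //; rewrite ?ltW ?nnegrE ?powR_ge0 //.
exact: le_trans (powR_ge0 _ _) hY.
Qed.

Lemma insoluble_half (R : realType) (n : nat) (zeta Y : R) :
  2 <= Y -> insoluble n zeta (1 / 2) Y.
Proof.
move=> Y2 x y xy.
have small (k : int) : `|k%:~R : R| <= 1 / 2 -> k = 0.
  rewrite -intr_norm => hk; apply/eqP; rewrite -normr_eq0 eq_le normr_ge0 andbT.
  by rewrite -ltzD1 add0r -(ltr_int R); lra.
move=> /small x0; case: xy => [|[i yi]]; first by rewrite x0.
move=> /(_ i); rewrite x0 mulr0 sub0r normrN => hi.
have hY : Y^-1 <= 1 / 2 by rewrite div1r lef_pV2 ?posrE //; lra.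
by move: yi; rewrite (small _ (le_trans hi hY)).
Qed.

(** The left side is the distance bound [c / (X Y)] at [X = Y^tau / 2], of order [Y^(-tau - 1)]; the
    gap [tau - nu] absorbs [c] and [M] for large [Y]. *)
Lemma cdist_bound_exponent (R : realType) (M c tau nu : R) :
  0 < M -> 0 < c -> nu < tau ->
  exists Y0 : R, forall Y, 1 <= Y -> Y0 <= Y ->
    c / (Y `^ tau / 2 * Y) <= (M * Y) `^ (- nu - 1).
Proof.
move=> M0 c0 nt; have e0 : 0 < tau - nu by rewrite subr_gt0.
have [Y0 hY] := powR_unbounded (2 * c * M `^ (nu + 1)) e0.
exists Y0 => Y Y1 /hY {}hY; have Y0' : 0 < Y by lra.
have Yn0 : Y != 0 by rewrite gt_eqF.
have -> : Y `^ tau = Y `^ (tau - nu) * Y `^ nu.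
  by rewrite -powRD ?subrK // Yn0 implybT.
rewrite -opprD powRN powRM ?(ltW M0) ?(ltW Y0') //.
rewrite (@powRD _ Y nu) ?Yn0 ?implybT // (powRr1 (ltW Y0')).
have a0 : 0 < Y `^ nu by apply: powR_gt0.
have b0 : 0 < Y `^ (tau - nu) by apply: powR_gt0.
have g0 : 0 < M `^ (nu + 1) by apply: powR_gt0.
move: (Y `^ nu) (Y `^ (tau - nu)) (M `^ (nu + 1)) a0 b0 g0 hY.
move=> a b g a0 b0 g0 hY.
rewrite ler_pdivrMr ?mulr_gt0 ?invr_gt0 //.
rewrite (_ : (g * (a * Y))^-1 * _ = b / 2 / g); last by field; rewrite !gt_eqF.
by rewrite ler_pdivlMr // ler_pdivlMr //; lra.
Qed.

Lemma seq_pos_lbound (R : realType) (T : eqType) (s : seq T) (f : T -> R) :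
  (forall a, a \in s -> 0 < f a) ->
  exists2 d : R, 0 < d & forall a, a \in s -> d <= f a.
Proof.
elim: s => [_|x s IH hf]; first by exists 1.
have [|d d0 hd] := IH; first by move=> a aS; rewrite hf // in_cons aS orbT.
exists (Num.min d (f x)); first by rewrite lt_min d0 hf ?mem_head.
by move=> a; rewrite in_cons ge_min => /predU1P[->|/hd ->//]; rewrite lexx orbT.
Qed.

(** * Comparison of the exponents *)

Section Exponents.
Variables (R : realType) (n : nat) (zeta : R).
Hypotheses (n1 : (1 <= n)%N) (nalg : ~ algebraic_le n (zeta%:C)%C).

Lemma minpoly_height_ge1 (P : {poly int}) (alpha : R[i]) :
  minpoly_Z_le n P alpha -> 1 <= height R P.
Proof.
by case=> /andP[s1 _] _ _ _; rewrite height_ge1 // -size_poly_gt0 ltnW.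
Qed.

Lemma cdist_gt0 (P : {poly int}) (alpha : R[i]) :
  minpoly_Z_le n P alpha -> 0 < cdist zeta alpha.
Proof.
move=> mP; rewrite lt0r sqrtr_ge0 andbT; apply/eqP => d0.
apply: nalg; exists P; suff -> : (zeta%:C)%C = alpha by [].
by apply/eqP; rewrite -subr_eq0 -normr_eq0 norm_sub_cdist d0.
Qed.

(* The factor 1/2 makes tau = 0 admissible: |x| <= 1/2 forces x = 0, so the
   system is then insoluble for every Y >= 2. *)
Lemma le_w_star (tau : R) : 0 <= tau ->
  (forall Y0 : R, exists2 Y, Y0 <= Y & insoluble n zeta (Y `^ tau / 2) Y) ->
  (tau%:E <= w_star n zeta)%E.
Proof.
move=> tau0 hins; have [M [c [M0 c0 happ]]] := algebraic_approx n1 nalg.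
(* The cut-off at -1 keeps [- nu - 1] nonpositive, so that the bound at [M * Y] passes to the
   smaller height of [P]. *)
apply/lee_subgt0Pr => e e0; pose nu := Num.max (tau - e) (-1).
have nut : nu < tau by rewrite gt_max; apply/andP; split; lra.
have nu1 : -1 <= nu by rewrite le_max lexx orbT.
apply: (@le_trans _ _ nu%:E); first by rewrite -EFinB lee_fin le_max lexx.
apply: ereal_sup_ubound; exists nu => // /finite_seqP[s sE].
have sP alpha : alpha \in s -> exists P, minpoly_Z_le n P alpha /\
    cdist zeta alpha <= height R P `^ (- nu - 1).
  by move=> aS; have : [set` s]%classic alpha := aS; rewrite -sE.
have [d d0 hd] : exists2 d : R, 0 < d & forall a, a \in s -> d <= cdist zeta a.
  by apply: seq_pos_lbound => a /sP[P [mP _]]; apply: cdist_gt0 mP.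
have [Y0 hY0] := cdist_bound_exponent M0 c0 nut.
(* A finite list of solutions would stay at distance [d] from [zeta]; as [Y^tau >= 1], taking
   [Y > 2 * c / d] gives a solution closer than that. *)
have [Y Yge insY] := hins (Num.max Y0 (Num.max 1 (2 * c / d + 1))).
move: Yge; rewrite !ge_max => /and3P[Y0Y Y1 Yd].
have Ytau : 1 <= Y `^ tau.
  by rewrite -(powRr0 Y); apply: ler_powR.
have Y2 : 1 / 2 <= Y `^ tau / 2 by lra.
have [alpha [P [mP hP dP]]] := happ _ _ Y2 Y1 insY.
have YP : 0 < Y by lra.
have : alpha \in s.
  suff : [set` s]%classic alpha by [].
  rewrite -sE; exists P; split=> //.
  apply: le_trans dP (le_trans (hY0 _ Y1 Y0Y) _).
  have hP0 : 0 < height R P := lt_le_trans ltr01 (minpoly_height_ge1 mP).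
  rewrite -opprD !powRN lef_pV2 ?posrE ?powR_gt0 ?mulr_gt0 //.
  by apply: ge0_ler_powR; rewrite ?nnegrE //; lra.
move=> /hd; rewrite leNgt => /negP; apply; apply: le_lt_trans dP _.
rewrite ltr_pdivrMr ?mulr_gt0 //; last lra.
have : 2 * c < Y * d by rewrite -ltr_pdivrMr //; lra.
have : Y * d <= Y `^ tau * (Y * d) by rewrite ler_peMl // mulr_ge0 // ltW.
lra.
Qed.

Lemma le_hw_star (tau : R) : 0 <= tau ->
  (exists Y0 : R, forall Y, Y0 <= Y -> insoluble n zeta (Y `^ tau / 2) Y) ->
  (tau%:E <= hw_star n zeta)%E.
Proof.
move=> tau0 [Y1 hins]; have [M [c [M0 c0 happ]]] := algebraic_approx n1 nalg.
apply/lee_subgt0Pr => e e0; rewrite -EFinB.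
have nut : tau - e < tau by lra.
apply: ereal_sup_ubound; exists (tau - e) => //.
have [Y0 hY0] := cdist_bound_exponent M0 c0 nut.
(* [Y = H / M] turns the height bound [M * Y] into [H]. *)
exists (M * Num.max Y0 (Num.max 1 Y1)) => H; rewrite mulrC -ler_pdivlMr //.
set Y := H / M; have -> : H = M * Y by rewrite /Y mulrC divfK ?gt_eqF.
rewrite !ge_max => /and3P[Y0Y Yge1 Y1Y].
have Ytau : 1 <= Y `^ tau.
  by rewrite -(powRr0 Y); apply: ler_powR.
have Y2 : 1 / 2 <= Y `^ tau / 2 by lra.
have [alpha [P [mP hP dP]]] := happ _ _ Y2 Yge1 (hins _ Y1Y).
exists alpha, P; split=> //; apply: le_trans dP (le_trans (hY0 _ Yge1 Y0Y) _).
have MY0 : 0 < M * Y by rewrite mulr_gt0 //; lra.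
have hP1 := minpoly_height_ge1 mP.
(* One factor [(M * Y)^-1] is split off and bounded by the inverse height. *)
rewrite [- _ - 1]addrC powRD; last by rewrite (gt_eqF MY0) implybT.
rewrite powR_inv1 ?(ltW MY0) //.
by rewrite ler_wpM2r ?powR_ge0 // lef_pV2 ?posrE // (lt_le_trans ltr01).
Qed.

(** With [Y = X^(1/tau)] one has [Y^tau = X] and [1 / Y = X^(-1/tau)]; the factor 1/2 only shrinks
    the range of [x]. *)
Lemma insoluble_of_approx (X tau : R) : 0 < X -> 0 < tau ->
  ~ approx_sys n zeta X tau^-1 ->
  insoluble n zeta ((X `^ tau^-1) `^ tau / 2) (X `^ tau^-1).
Proof.
move=> X0 tau0 napp x y xy hx hy; apply: napp; exists x, y; split=> //.
  apply: le_trans hx _; rewrite -powRrM mulVf ?gt_eqF // powRr1 ?(ltW X0) //.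
  by lra.
by move=> i; rewrite powRN.
Qed.

(** If [t < 1 / r], then [1 / t] exceeds the uniform exponent [r], so the system with exponent
    [1 / t] fails for arbitrarily large [X], hence for arbitrarily large [Y = X^(1/t)]. *)
Lemma einv_hw_prime_le : (einv (hw_prime n zeta) <= w_star n zeta)%E.
Proof.
(* This settles the infinite values, where [einv] is 0, and [r <= 0], where [r^-1 <= 0] with
   [0^-1 = 0]. *)
have w0 : (0 <= w_star n zeta)%E.
  apply: (@le_w_star 0) => // Y0.
  exists (Num.max Y0 2); rewrite ?le_max ?lexx //.
  by rewrite powRr0; apply: insoluble_half; rewrite le_max lexx orbT.
case E : (hw_prime n zeta) => [r| |] //=.
have [r0|r0] := leP r 0.
  by apply: le_trans w0; rewrite lee_fin invr_le0.
apply/lee_subgt0Pr => e e0; rewrite -EFinB.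
have [t0|t0] := leP (r^-1 - e) 0; first by apply: le_trans w0; rewrite lee_fin.
set t := r^-1 - e in t0 *; apply: le_w_star; first exact: ltW.
have mu_r : r < t^-1 by rewrite -[r]invrK ltf_pV2 ?posrE ?invr_gt0 // /t; lra.
move=> Y0; have mu0 : 0 < t^-1 by rewrite invr_gt0.
have [X0 hX0] := powR_unbounded Y0 mu0.
apply: contrapT => nY.
suff : (t^-1%:E <= hw_prime n zeta)%E by rewrite E lee_fin leNgt mu_r.
apply: ereal_sup_ubound; exists t^-1 => //; exists (Num.max 1 X0) => X.
rewrite ge_max => /andP[X1 /hX0 X0X]; apply: contrapT => napp; apply: nY.
exists (X `^ t^-1) => //.
by apply: insoluble_of_approx napp => //; lra.
Qed.

(** The quantifiers are exchanged: [1 / t] now exceeds the ordinary exponent, so the system fails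
    for every large [X]. *)
Lemma einv_w_prime_le : (einv (w_prime n zeta) <= hw_star n zeta)%E.
Proof.
have w0 : (0 <= hw_star n zeta)%E.
  apply: (@le_hw_star 0) => //; exists 2 => Y Y2.
  by rewrite powRr0; apply: insoluble_half.
case E : (w_prime n zeta) => [r| |] //=.
have [r0|r0] := leP r 0.
  by apply: le_trans w0; rewrite lee_fin invr_le0.
apply/lee_subgt0Pr => e e0; rewrite -EFinB.
have [t0|t0] := leP (r^-1 - e) 0; first by apply: le_trans w0; rewrite lee_fin.
set t := r^-1 - e in t0 *; apply: le_hw_star; first exact: ltW.
have mu_r : r < t^-1 by rewrite -[r]invrK ltf_pV2 ?posrE ?invr_gt0 // /t; lra.
have mu0 : 0 < t^-1 by rewrite invr_gt0.
apply: contrapT => nY.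
suff : (t^-1%:E <= w_prime n zeta)%E by rewrite E lee_fin leNgt mu_r.
apply: ereal_sup_ubound; exists t^-1 => // X0; apply: contrapT => nX; apply: nY.
have [Y0 hY0] := powR_unbounded X0 t0.
exists (Num.max 1 Y0) => Y; rewrite ge_max => /andP[Y1 /hY0 X0Y].
(* Every large [Y] is [X^(1/t)] for the large [X = Y^t], so no value of [Y] is missed. *)
have -> : Y = (Y `^ t) `^ t^-1.
  by rewrite -powRrM mulfV ?gt_eqF // powRr1 //; lra.
apply: insoluble_of_approx => //; first by rewrite powR_gt0 //; lra.
by move=> app; apply: nX; exists (Y `^ t).
Qed.
End Exponents.

Theorem theorem2 (R : realType) (n : nat) (zeta : R) :
  (1 <= n)%N ->
  ~ algebraic_le n (zeta%:C)%C ->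
  (einv (hw_prime n zeta) <= w_star n zeta)%E /\
  (einv (w_prime n zeta) <= hw_star n zeta)%E.
Proof.
move=> n1 nalg; split; first exact: einv_hw_prime_le.
exact: einv_w_prime_le.
Qed.
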